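(* There is an absolute constant $c_0>0$ with the following property. Let $A\subset\Omega$ be a finite-symmetric subset of zero measure (in the sense defined in the context), and let $\Lambda=(\lambda_n)_{n\ge1}$ be an unbounded, monotonically increasing sequence of positive real numbers, any finite subfamily of elements of which is linearly independent over the field of rational numbers. Let $\varepsilon>0$, let $B\supset A$ be any subset of $\Omega$ that is open in the Tychonoff metric $d$ and satisfies $\mu_0(B)<\varepsilon$, and let $$E_0=\{\,0\le t\le1\mid\{t\Lambda\}\in A\ \wedge\ \Sigma'(\{t\Lambda\})\subset B\,\}.$$ Then $m(E_0)\le c_0\varepsilon$, where $m$ is the Lebesgue measure.
   Context: $\Omega=\{(x_n)_{n\ge1}\mid 0\le x_n\le1,\ n=1,2,\ldots\}$ is the infinite dimensional unit cube with the (Tychonoff) metric $d(x,y)=\sum_{n=1}^{\infty}e^{1-n}|x_n-y_n|$. Open balls are $B(\theta,r)=\{x\in\Omega\mid d(x,\theta)<r\}$, $\theta\in\Omega$, $r>0$. Finite permutations: $\Sigma$ is the group (under composition) of all bijections $\sigma:\mathbb N\to\mathbb N$ for which there is a natural number $m$ with $\sigma(n)=n$ for all $n>m$. It is countable, and its elements are arranged in a sequence. For $\omega=(\omega_n)\in\Omega$ put $\sigma\omega=(\omega_{\sigma(n)})$ and $\Sigma(\omega)=\{\sigma\omega\mid\sigma\in\Sigma\}$; $\Sigma'(\omega)$ denotes the (closed) set of all limit points of the sequence $\Sigma(\omega)$. A subset $A\subset\Omega$ is finite-symmetric if $\sigma\theta\in A$ for every $\theta\in A$ and every $\sigma\in\Sigma$.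 For real $t$ and $\Lambda=(\lambda_n)$, $\{t\Lambda\}=(\{t\lambda_n\})_{n\ge1}\in\Omega$, where $\{x\}$ is the fractional part of a real number $x$. The set function $\mu_0$: for a ball, $\mu_0(B(\theta,r))=\lim_{N\to\infty}\mathrm{vol}_N(B_N(\theta,r))$, where $B_N(\theta,r)=\{(x_1,\ldots,x_N)\in[0,1]^N\mid\sum_{n=1}^{N}e^{1-n}|x_n-\theta_n|<r\}$ is the projection of the ball onto the first $N$ coordinates and $\mathrm{vol}_N$ is $N$-dimensional Lebesgue measure. In the same way (by limits of volumes of projections, and with complements of balls having measure $1-\mu_0(B(\theta,r))$) $\mu_0$ is defined as a finitely additive set function on the algebra generated by the open balls; it is the restriction of the product Lebesgue measure to this algebra, and it is extended uniquely to a measure $\mu_0$ on the generated $\sigma$-algebra $\Xi$. Zero measure: $A\subset\Omega$ is a subset of zero measure if for any $\varepsilon>0$ there exist open balls $B_1,B_2,\ldots$ such that $A\subset\bigcup_{k=1}^{\infty}B_k$, none of these balls contains any other, and $\sum_{k=1}^{\infty}\mu_0(B_k)<\varepsilon$. *)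

(* Defs.v *)
(* Sequences are indexed from 0, so the weight e^(1-n) of the n-th coordinate,
   n >= 1, becomes e^(-n), n >= 0. *)
From HB Require Import structures.
From mathcomp Require Import all_boot all_order all_algebra finmap.
From mathcomp Require Import lra.
From mathcomp Require Import all_classical all_reals all_analysis.

Set Implicit Arguments.
Unset Strict Implicit.
Unset Printing Implicit Defensive.

Import Order.TTheory GRing.Theory Num.Theory.
Import numFieldNormedType.Exports.

Local Open Scope classical_set_scope.
Local Open Scope ring_scope.

Definition Omega (R : realType) := nat -> {i01 R}.

HB.instance Definition _ (R : realType) := Choice.on (Omega R).
HB.instance Definition _ (R : realType) :=
  isPointed.Build (Omega R) (fun=> 0%:i01).

Section metric.
Variable R : realType.
Implicit Types x y z : Omega R.

Definition dterm x y : R^nat :=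
  fun n => expR (- n%:R) * `|(x n)%:num - (y n)%:num|.

Definition tychonoff_dist x y : R := limn (series (dterm x y)).

Lemma dterm_ge0 x y n : 0 <= dterm x y n.
Proof. by rewrite /dterm mulr_ge0// expR_ge0. Qed.

Lemma is_cvg_dterm x y : cvgn (series (dterm x y)).
Proof.
apply: (@series_le_cvg _ _ (geometric 1 (expR (-1)))).
- exact: dterm_ge0.
- by move=> n; rewrite /geometric/= mul1r exprn_ge0// expR_ge0.
- move=> n; rewrite /geometric/= mul1r /dterm -expRM_natl mulrN1.
  rewrite -[leRHS]mulr1 ler_wpM2l ?expR_ge0//.
  have x0 : 0 <= (x n)%:num by [].
  have x1 : (x n)%:num <= 1 by [].
  have y0 : 0 <= (y n)%:num by [].
  have y1 : (y n)%:num <= 1 by [].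
  by rewrite ler_norml; lra.
- apply: is_cvg_geometric_series.
  by rewrite ger0_norm ?expR_ge0// -expR0 ltr_expR ltrN10.
Qed.

Lemma series_dterm_le x y n : series (dterm x y) n <= tychonoff_dist x y.
Proof.
apply: nondecreasing_cvgn_le; last exact: is_cvg_dterm.
by apply/nondecreasing_seqP => k; rewrite !seriesEnat/= big_nat_recr//= lerDl dterm_ge0.
Qed.

Lemma tychonoff_distxx x : tychonoff_dist x x = 0.
Proof.
rewrite /tychonoff_dist (_ : series _ = fun=> 0) ?lim_cst//.
by apply/funext => n; rewrite seriesEnat/= big1// => i _; rewrite /dterm subrr normr0 mulr0.
Qed.

Lemma tychonoff_dist_eq0 x y : tychonoff_dist x y = 0 -> x = y.
Proof.
move=> d0; apply/funext => n; apply/val_inj/eqP => /=.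
have := series_dterm_le x y n.+1; rewrite d0 seriesEnat/= big_nat_recr//=.
move=> le0; have {le0} : dterm x y n <= 0.
  by apply: le_trans le0; rewrite lerDr sumr_ge0// => i _; exact: dterm_ge0.
by rewrite /dterm pmulr_rle0 ?expR_gt0// normr_le0 subr_eq0.
Qed.

Lemma tychonoff_dist_sym x y : tychonoff_dist x y = tychonoff_dist y x.
Proof.
congr (limn (series _)); apply/funext => n; by rewrite /dterm distrC.
Qed.

Lemma tychonoff_dist_triangle y x z :
  tychonoff_dist x z <= tychonoff_dist x y + tychonoff_dist y z.
Proof.
rewrite -limD; [|exact: is_cvg_dterm..].
apply: ler_lim; [exact: is_cvg_dterm| |].
  by apply: is_cvgD; exact: is_cvg_dterm.
apply: nearW => n; rewrite fctE !seriesEnat/= -big_split/=.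
by apply: ler_sum => i _; rewrite /dterm -mulrDr ler_wpM2l ?expR_ge0// ler_distD.
Qed.

End metric.

HB.instance Definition _ (R : realType) := isMetric.Build R (Omega R)
  (@tychonoff_distxx R) (@tychonoff_dist_eq0 R) (@tychonoff_dist_sym R)
  (@tychonoff_dist_triangle R).

Section measure0.
Variable R : realType.

Definition open_balls : set (set (Omega R)) :=
  [set U | exists theta r, 0 < r /\ U = ball theta r].

(* The ring of sets generated by the balls is an algebra, because the whole
   space is itself a ball. *)
Definition ball_algebra : set (set (Omega R)) := <<r open_balls >>.

Definition Xi := g_sigma_algebraType open_balls.

(* N-dimensional Lebesgue measure on N-tuples, built as an iterated product:
   only its values on Borel sets are meaningful. *)
Fixpoint vol (N : nat) : set (N.-tuple R) -> \bar R :=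
  match N with
  | 0 => \d_[tuple]
  | N'.+1 => pushforward (lebesgue_measure \x @vol N')%E
               (fun p : measurableTypeR R * N'.-tuple R => [tuple of p.1 :: p.2])
  end.

Definition first_coords (N : nat) (x : Omega R) : N.-tuple R :=
  [tuple (x i)%:num | i < N].

Lemma first_coords_ball N (theta : Omega R) r : 0 < r ->
  first_coords N @` ball theta r =
  [set u | (forall i, 0 <= tnth u i <= 1) /\
           \sum_(i < N) expR (- i%:R) * `|tnth u i - (theta i)%:num| < r].
Proof.
move=> r0; apply/seteqP; split=> [_ [x /= xr <-]|u /= [u01 ur]].
  split=> [i|].
    rewrite tnth_mktuple.
    have x0 : 0 <= (x i)%:num by [].
    have x1 : (x i)%:num <= 1 by [].
    by rewrite x0 x1.
  rewrite ballEmdist/= in xr.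
  apply: le_lt_trans xr; rewrite /mdist/= tychonoff_dist_sym.
  apply: le_trans (series_dterm_le x theta N).
  rewrite seriesEord/=; apply: ler_sum => i _.
  by rewrite tnth_mktuple.
pose x : Omega R := fun n => if insub n is Some i then
  Itv01 (proj1 (andP (u01 i))) (proj2 (andP (u01 i))) else theta n.
have xE (i : 'I_N) : (x i)%:num = tnth u i by rewrite /x valK.
exists x; last by apply: eq_from_tnth => i; rewrite tnth_mktuple xE.
rewrite ballEmdist/=; apply: le_lt_trans ur.
rewrite /mdist/= tychonoff_dist_sym.
apply: limr_le; first exact: is_cvg_dterm.
near=> n; have Nn : (N <= n)%N by near: n; exact: nbhs_infty_ge.
rewrite seriesEnat/= (big_cat_nat (leq0n N) Nn)//= [X in _ + X]big1_seq ?addr0.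
  by rewrite big_mkord; apply: ler_sum => i _; rewrite /dterm xE.
move=> i /=; rewrite mem_index_iota => /andP[Ni _].
by rewrite /dterm /x insubF ?subrr ?normr0 ?mulr0// ltnNge Ni.
Unshelve. all: by end_near. Qed.

(* The algebra is stable under intersection, contains the whole space and
   generates Xi, so at most one measure satisfies is_mu0: the unique extension
   to Xi of the set function defined by limits of volumes of projections. *)
Definition is_mu0 (mu0 : {measure set Xi -> \bar R}) :=
  forall A, ball_algebra A -> vol (first_coords N @` A) @[N --> \oo] --> mu0 A.

Definition zero_measure (mu0 : {measure set Xi -> \bar R})
    (A : set (Omega R)) :=
  forall e : R, 0 < e -> exists (theta : nat -> Omega R) (r : nat -> R),
    [/\ forall k, 0 < r k,
        A `<=` \bigcup_k ball (theta k) (r k),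
        forall j k, j != k -> ~ (ball (theta j) (r j) `<=` ball (theta k) (r k))
      & (\sum_(0 <= k <oo) mu0 (ball (theta k) (r k)) < e%:E)%E].

End measure0.

Definition finite_perm : set (nat -> nat) :=
  [set s | bijective s /\ exists m, forall n, (m <= n)%N -> s n = n].

Section statement_notions.
Variable R : realType.

Definition permute (s : nat -> nat) (w : Omega R) : Omega R := fun n => w (s n).

Definition finite_symmetric (A : set (Omega R)) :=
  forall theta s, A theta -> finite_perm s -> A (permute s theta).

(* sg is the chosen enumeration of finite_perm; being a cluster point of
   (sg k w)_k does not depend on that choice. *)
Definition limit_points (sg : nat -> nat -> nat) (w : Omega R) :
  set (Omega R) := cluster (permute (sg k) w @[k --> \oo]).

Definition frac (x : R) : R := x - (Num.floor x)%:~R.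

Lemma frac_ge0 x : 0 <= frac x.
Proof. by rewrite subr_ge0 floor_le. Qed.

Lemma frac_le1 x : frac x <= 1.
Proof. by rewrite lerBlDl -(intrD _ _ 1) ltW ?floorD1_gt. Qed.

Definition frac_seq (t : R) (L : R^nat) : Omega R :=
  fun n => Itv01 (frac_ge0 (t * L n)) (frac_le1 (t * L n)).

Definition rat_independent (L : R^nat) :=
  forall (I : {fset nat}) (c : nat -> rat),
    \sum_(i <- I) ratr (c i) * L i = 0 -> forall i, i \in I -> c i = 0.

End statement_notions.

(* Main.v *)
(* Idea.  For t in E_0 the orbit of {t Lambda} under finite permutations stays
   in A, hence in B, and so do its limit points; as Omega is compact, some
   d-neighbourhood of the whole orbit lies in B.  The d-interior of B is covered
   by a finite union W of balls inside B, and for a large dimension N the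
   projection of W to [0,1]^N has volume < eps.  Cut [0,1]^N into cubes of a grid
   so fine that every cube met by the projected orbit lies in the projection
   of W.  Since lambda is unbounded one may choose indices m_1 < ... < m_N along
   which lambda grows so fast that, for each cube, the set of t in [0,1] with
   ({t lambda_(m_i)})_i in the cube has measure at most twice the volume of the
   cube.  A finite permutation moves m_i to position i, so the t with a
   neighbourhood of size d lie in a set of measure at most 2 eps.  Apply this to
   d = 1/(k+1), k -> oo. *)
Require Import Defs.
From HB Require Import structures.
From mathcomp Require Import all_boot all_order all_algebra finmap.
From mathcomp Require Import all_classical all_reals all_analysis.
From mathcomp Require Import measurable_realfun lra.

Set Implicit Arguments.
Unset Strict Implicit.
Unset Printing Implicit Defensive.

Import Order.TTheory GRing.Theory Num.Theory.
Import numFieldNormedType.Exports.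

Local Open Scope classical_set_scope.
Local Open Scope ring_scope.

Section lemmas.
Variable R : realType.

(** * Volumes and grids *)

(* The integral of a nonnegative function is a supremum over simple functions,
   hence monotone without measurability.  This is what bounds [vol], which is
   only a set function, from below on arbitrary sets. *)
Lemma ge0_le_integral_nonmeasurable d (T : measurableType d) (mu : {measure set T -> \bar R})
    (f g : T -> \bar R) : (forall x, 0 <= f x)%E -> (forall x, f x <= g x)%E ->
  (\int[mu]_x f x <= \int[mu]_x g x)%E.
Proof.
move=> f0 fg.
have g0 x : (0 <= g x)%E := le_trans (f0 x) (fg x).
rewrite !ge0_integralE// !patch_setT; apply: ge_ereal_sup => _ [h hf <-].
by apply: ereal_sup_ubound; exists h => // x; exact: le_trans (fg x).
Qed.

Definition grid_cell (M k : nat) (x : R) := k%:R <= M%:R * x < k.+1%:R.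

Lemma grid_cell_inj M k l x : grid_cell M k x -> grid_cell M l x -> k = l.
Proof.
move=> /andP[k1 k2] /andP[l1 l2]; apply/eqP; rewrite eqn_leq.
by rewrite -ltnS -(ltr_nat R) (le_lt_trans k1 l2)/= -ltnS -(ltr_nat R) (le_lt_trans l1 k2).
Qed.

Lemma grid_cellE M k : (0 < M)%N ->
  [set x | grid_cell M k x] = `[k%:R / M%:R, k.+1%:R / M%:R[%classic.
Proof.
move=> M0; apply/seteqP; split => x /=; rewrite in_itv/= /grid_cell;
  by rewrite ler_pdivrMr ?ltr_pdivlMr ?ltr0n// mulrC.
Qed.

Lemma lebesgue_grid_cell M k : (0 < M)%N ->
  lebesgue_measure [set x | grid_cell M k x] = (M%:R^-1)%:E.
Proof.
move=> M0; rewrite grid_cellE// lebesgue_measure_itv/= lte_fin.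
rewrite ltr_pM2r ?invr_gt0 ?ltr0n// ltr_nat ltnSn -EFinB -mulrBl.
by rewrite -natr1 addrAC subrr add0r div1r.
Qed.

(** Induction on [N] by slicing along the first coordinate: over a point of the [i]-th cell, the
    section of [V] contains the cells of the tails of those tuples of [S] that start with [i]. [V]
    is arbitrary, so that projections can be plugged in directly. *)
Lemma vol_ge_grid M N (V : set (N.-tuple R)) (S : {set N.-tuple 'I_M}) : (0 < M)%N ->
  (forall c, c \in S ->
    [set u | forall i, grid_cell M (tnth c i) (tnth u i)] `<=` V) ->
  ((#|S|%:R / M%:R ^+ N)%:E <= vol V)%E.
Proof.
move=> M0; elim: N V S => [|N IH] V S SV.
  rewrite expr0 divr1 /vol/= diracE.
  have [->|/finset.set0Pn[c cS]] := eqVneq S finset.set0.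
    by rewrite cards0 lee_fin ler0n.
  rewrite mem_set; last by apply: (SV _ cS) => -[].
  by rewrite lee_fin ler_nat (leq_trans (max_card _))// card_tuple expn0.
pose T (i : 'I_M) := finset (fun c : N.-tuple 'I_M => [tuple of i :: c] \in S).
have cardS : #|S| = (\sum_(i < M) #|T i|)%N.
  rewrite -sum1_card (partition_big (@thead _ _) xpredT)//=.
  apply: eq_bigr => i _; rewrite -sum1_card.
  rewrite (reindex_onto (fun c : N.-tuple 'I_M => [tuple of i :: c])
     (fun c => [tuple of behead c])) /=; last first.
    by move=> c /andP[_ /eqP <-]; rewrite [RHS]tuple_eta.
  apply: eq_bigl => c; rewrite finset.in_set theadE eqxx andbT.
  have -> : [tuple of behead [tuple of i :: c]] = c by exact: val_inj.
  by rewrite eqxx andbT.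
(* A step function lying below the volume of the sections of [V]; its integral is the claimed
   bound. *)
pose f (x : R) : \bar R := (\sum_(i < M)
   (#|T i|%:R / M%:R ^+ N)%:E * (\1_[set x | grid_cell M i x] x)%:E)%E.
have f0 x : (0 <= f x)%E.
  apply: sume_ge0 => i _; rewrite -EFinM lee_fin mulr_ge0// ?indicE ?ler0n//.
have mcell (i : 'I_M) : measurable [set x : measurableTypeR R | grid_cell M i x].
  by rewrite grid_cellE//; exact: measurable_itv.
have -> : ((#|S|%:R / M%:R ^+ N.+1)%:E = \int[lebesgue_measure]_x f x)%E.
  rewrite ge0_integral_sum//=.
  - rewrite cardS natr_sum mulr_suml -sumEFin; apply: eq_bigr => i _.
    rewrite ge0_integralZl_EFin//=.
    + rewrite integral_indic// setIT.
      rewrite [X in (_ * X)%E](lebesgue_grid_cell i M0) -EFinM.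
      by rewrite exprS invfM mulrA mulrAC.
    + by apply/measurable_EFinP; exact: measurable_indic.
  - move=> i; apply: measurable_funeM.
    by apply/measurable_EFinP; exact: measurable_indic.
rewrite /vol -/vol /pushforward /product_measure1.
apply: ge0_le_integral_nonmeasurable => // x; rewrite /f /=.
have [[i xi]|nx] := pselect (exists i : 'I_M, grid_cell M i x); last first.
  rewrite big1 => [|i _]; last first.
    by rewrite indicE memNset ?mule0// => xi; apply: nx; exists i.
  (* Off the grid only nonnegativity of the section's volume is needed: the induction hypothesis for
     the empty family. *)
  have := IH (xsection ((fun p : R * N.-tuple R => [tuple of p.1 :: p.2]) @^-1` V) x)
    finset.set0.
  by rewrite cards0 mul0r; apply => c; rewrite finset.in_set0.
rewrite (bigD1 i)//= [X in (_ + X)%E]big1 ?adde0 => [|j ji]; last first.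
  rewrite indicE memNset ?mule0// => xj; move/eqP: ji; apply.
  by apply/val_inj; exact: grid_cell_inj xj xi.
rewrite indicE mem_set// mule1; apply: IH => c; rewrite finset.in_set => cS u uc.
rewrite /xsection/= inE/=; apply: (SV _ cS) => j.
case: (unliftP ord0 j) => [k|] ->; last by rewrite !tnth0.
by rewrite !tnthS.
Qed.

(** * Lacunary frequencies *)

(** No measurability is required because [lebesgue_measure] is the outer measure generated by
    interval length. *)
Lemma le_lebesgue_measure (A B : set R) : A `<=` B ->
  (lebesgue_measure A <= lebesgue_measure B)%E.
Proof. exact: (le_outer_measure (mu_ext (@wlength R idfun))). Qed.

Lemma lebesgue_measure_bigsetU (I : Type) (r : seq I) (P : pred I) (F : I -> set R) :
  (lebesgue_measure (\big[setU/set0]_(i <- r | P i) F i) <=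
   \sum_(i <- r | P i) lebesgue_measure (F i))%E.
Proof.
elim/big_rec2: _ => [|i x A _ le_Ax]; first by rewrite measure0.
have := outer_measureU2 (mu_ext (@wlength R idfun)) (F i) A.
by move/le_trans; apply; rewrite leeD2l.
Qed.

Lemma exists_large (L : R^nat) (X : R) m0 : nondecreasing_seq L ->
  ~ has_ubound (range L) -> exists2 m, (m0 <= m)%N & X <= L m.
Proof.
move=> Lincr Lunb; apply: contrapT => h; apply: Lunb; exists X => _ [n _ <-].
rewrite (le_trans (Lincr _ _ (leq_maxl n m0)))// leNgt; apply/negP => XL.
by apply: h; exists (maxn n m0); [exact: leq_maxr|exact: ltW].
Qed.

Definition hits (L : R^nat) M N (m : N.-tuple nat) (c : N.-tuple 'I_M) (a b : R) :=
  [set t : R | a <= t <= b /\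
    forall i, grid_cell M (tnth c i) (Defs.frac (t * L (tnth m i)))].

(* The first condition confines t to intervals of length 1/(M L_n), one for each
   value of floor (t L_n). *)
Lemma hits_cons (L : R^nat) M N (n : nat) (m : N.-tuple nat) (k : 'I_M)
    (c : N.-tuple 'I_M) (a b : R) :
  (0 < M)%N -> 0 < L n -> a <= b ->
  hits L [tuple of n :: m] [tuple of k :: c] a b `<=`
  \big[setU/set0]_(j < `|Num.floor (b * L n) - Num.floor (a * L n)|.+1)
    hits L m c ((((Num.floor (a * L n))%:~R + j%:R) + k%:R / M%:R) / L n)
               ((((Num.floor (a * L n))%:~R + j%:R) + k.+1%:R / M%:R) / L n).
Proof.
move=> M0 Ln0 ab t [/andP[at_ tb] tc].
have le1 : (Num.floor (a * L n) <= Num.floor (t * L n))%R.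
  by rewrite le_floor// ler_pM2r.
have le2 : (Num.floor (t * L n) <= Num.floor (b * L n))%R.
  by rewrite le_floor// ler_pM2r.
have jE : (Num.floor (t * L n) - Num.floor (a * L n))%R
    = (`|Num.floor (t * L n) - Num.floor (a * L n)|)%N :> int.
  by rewrite gez0_abs// subr_ge0.
have jK : (`|Num.floor (t * L n) - Num.floor (a * L n)| <
    `|Num.floor (b * L n) - Num.floor (a * L n)|.+1)%N.
  by rewrite ltnS -lez_nat !gez0_abs ?subr_ge0// ?lerB// (le_trans le1).
rewrite -bigcup_seq /=; exists (Ordinal jK) => //=; first exact: mem_index_enum.
set j := `|_|%N in jE jK *.
have qE : (Num.floor (a * L n))%:~R + j%:R = (Num.floor (t * L n))%:~R :> R.
  by rewrite -[j%:R]/(j%:Z%:~R) -jE -intrD addrC subrK.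
split=> [|i]; last by have := tc (lift ord0 i); rewrite !tnthS.
have := tc ord0; rewrite !tnth0 qE /grid_cell /Defs.frac => /andP[c1 c2].
rewrite ler_pdivrMr// ler_pdivlMr//; apply/andP; split.
  by rewrite -lerBrDl ler_pdivrMr ?ltr0n// mulrC.
by rewrite -lerBlDl ler_pdivlMr ?ltr0n// mulrC ltW.
Qed.

(* The indices are chosen one after the other, the error allowed for the later
   frequencies being small compared with 1/(M L_n) for the first one. *)
Lemma measure_hits_le (L : R^nat) M N (d : R) m0 : (forall n, 0 < L n) ->
  nondecreasing_seq L -> ~ has_ubound (range L) -> (0 < M)%N -> 0 < d ->
  exists m : N.-tuple nat, [/\ uniq m, all (leq m0) m &
    forall (c : N.-tuple 'I_M) a b, 0 <= b - a <= 1 ->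
      (lebesgue_measure (hits L m c a b) <= ((b - a + d) / M%:R ^+ N)%:E)%E].
Proof.
move=> Lpos Lincr Lunb M0.
elim: N d m0 => [|N IH] d m0 d0.
  exists [tuple]; split => // c a b /andP[ab _].
  have : hits L [tuple] c a b `<=` `[a, b]%classic.
    by move=> t [tab _]; rewrite /= in_itv.
  move=> /le_lebesgue_measure /le_trans; apply.
  rewrite lebesgue_measure_itv/= expr0 divr1; case: ifPn => _.
    by rewrite -EFinB lee_fin lerDl ltW.
  by rewrite lee_fin addr_ge0// ltW.
(* This size gives both [1 <= l] and [2 / l <= d / 2]. *)
have [n m0n Ln] := exists_large (4 / d + 1) m0 Lincr Lunb.
have M0' : 0 < M%:R :> R by rewrite ltr0n.
have l0 := Lpos n; set l := L n in Ln l0 *.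
(* At most [l + 2] intervals occur below, so their accumulated errors, rescaled by [M], stay within
   [d / 2]. Starting at [n.+1] keeps the indices distinct. *)
have [//|m [um am mP]] := IH (d / (2 * M%:R * (l + 2))) n.+1.
  by rewrite divr_gt0// mulr_gt0// ?mulr_gt0// addr_gt0.
exists [tuple of n :: m]; split.
- rewrite /= um andbT; apply/negP => nm.
  by have := allP am _ nm; rewrite ltnn.
- by rewrite /= m0n; apply/allP => x /(allP am)/ltnW; exact: leq_trans.
move=> c a b /andP[ab1 ab2]; rewrite [c]tuple_eta.
have ab : a <= b by rewrite -subr_ge0.
have := hits_cons (m := m) (k := thead c) (c := [tuple of behead c]) M0 l0 ab.
move=> /le_lebesgue_measure /le_trans; apply.
apply: (le_trans (lebesgue_measure_bigsetU _ _ _)).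
pose w : R := M%:R^-1 / l.
have w0 : 0 <= w by rewrite mulr_ge0 ?invr_ge0 ?ltW.
have l1 : 1 <= l by rewrite (le_trans _ Ln)// lerDr divr_ge0// ltW.
have w1 : w <= 1.
  by rewrite ler_pdivrMr// mul1r (le_trans _ l1)// invf_le1// ler1n.
set K := `|_|%N.+1.
(* One unit is lost to rounding by the floors, the other counts both end values. *)
have KE : K%:R <= (b - a) * l + 2.
  have fab : (Num.floor (a * l) <= Num.floor (b * l))%R.
    by rewrite le_floor// ler_pM2r.
  rewrite /K -natr1 -[X in X + 1]/(Posz _)%:~R gez0_abs ?subr_ge0// intrD mulrNz.
  have := floor_le (b * l); have := floorD1_gt (a * l); rewrite intrD mulrBl.
  by set u := _%:~R; set v := (Num.floor (b * l))%:~R; lra.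
apply: (@le_trans _ _
    (\sum_(j < K) ((w + d / (2 * M%:R * (l + 2))) / M%:R ^+ N)%:E)%E).
  apply: lee_sum => j _.
  set x := _ / l; set y := _ / l.
  have yx : y - x = w.
    rewrite /y /x -mulrBl opprD addrACA subrr add0r -mulrBl -natr1.
    by rewrite addrAC subrr add0r mul1r.
  by rewrite -yx; apply: mP; rewrite yx w0 w1.
rewrite sumEFin lee_fin sumr_const card_ord -[X in X <= _]mulr_natl exprS.
rewrite (invfM _ (_ ^+ _)) !mulrA.
rewrite ler_pM2r ?invr_gt0 ?exprn_gt0// ler_pdivlMr//.
have l2 : 0 < l + 2 by rewrite addr_gt0.
have -> : K%:R * (w + d / (2 * M%:R * (l + 2))) * M%:R =
    K%:R * (l^-1 + d / 2 / (l + 2)).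
  rewrite -mulrA mulrDl; congr (_ * (_ + _)).
    by rewrite /w mulrAC mulVf ?mul1r// gt_eqF.
  by rewrite !invfM !mulrA [LHS]mulrAC mulfVK// gt_eqF.
apply: (@le_trans _ _ (((b - a) * l + 2) * (l^-1 + d / 2 / (l + 2)))).
  by rewrite ler_pM2r// addr_gt0 ?invr_gt0// !divr_gt0.
have h1 : ((b - a) * l + 2) * l^-1 <= (b - a) + d / 2.
  rewrite mulrDl mulfK ?gt_eqF// lerD2l ler_pdivrMr// mulrC.
  rewrite -ler_pdivrMr ?divr_gt0// invfM invrK mulrCA mulrC.
  by move: Ln; set z := d^-1; lra.
have h2 : ((b - a) * l + 2) * (d / 2 / (l + 2)) <= d / 2.
  rewrite mulrA ler_pdivrMr// mulrC ler_pM2l ?divr_gt0// lerD2r.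
  by rewrite ler_piMl// ltW.
by rewrite mulrDr; lra.
Qed.

(** Used for the limit at the end, where continuity from below needs measurable sets. *)
Lemma measurable_hits (L : R^nat) M N (m : N.-tuple nat) (c : N.-tuple 'I_M) (a b : R) :
  (0 < M)%N -> (forall n, 0 < L n) ->
  measurable (hits L m c a b : set (measurableTypeR R)).
Proof.
move=> M0 Lpos.
have -> : hits L m c a b = `[a, b]%classic `&`
    \bigcap_(i in [set: 'I_N]) ((fun t => Defs.frac (t * L (tnth m i))) @^-1`
      [set x | grid_cell M (tnth c i) x]).
  apply/seteqP; split => [t [tab tc]|t [/= tab tc]].
    by split; [rewrite /= in_itv|move=> i _; exact: tc].
  by split; [move: tab; rewrite in_itv|move=> i; exact: tc].
apply: measurableI; first exact: measurable_itv.
apply: fin_bigcap_measurable; first exact: finite_finset.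
move=> i _; rewrite -[X in measurable X]setTI.
have mf : measurable_fun setT (fun t : measurableTypeR R => Defs.frac (t * L (tnth m i))).
  apply: measurable_funB; first exact: mulrr_measurable.
  apply: nondecreasing_measurable => // s t st.
  by rewrite ler_int le_floor// ler_pM2r.
by apply: mf => //; rewrite grid_cellE//; exact: measurable_itv.
Qed.

End lemmas.

(** * Finite permutations *)

Definition swap_nat (a b n : nat) := if n == a then b else if n == b then a else n.

Lemma swap_natK a b : involutive (swap_nat a b).
Proof.
move=> n; rewrite /swap_nat; have [->|na] := eqVneq n a.
  by rewrite eqxx; case: eqVneq.
by have [->|nb] := eqVneq n b; rewrite ?eqxx// (negbTE na) (negbTE nb).
Qed.

Lemma finite_perm_swap a b s : finite_perm s -> finite_perm (swap_nat a b \o s).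
Proof.
move=> [bs [m sm]]; split; first exact: bij_comp (inv_bij (swap_natK a b)) bs.
exists (maxn m (maxn a.+1 b.+1)) => n; rewrite !geq_max => /andP[mn /andP[an bn]].
by rewrite /= sm// /swap_nat !gtn_eqF.
Qed.

Lemma finite_perm_extend (m : seq nat) : uniq m ->
  exists2 s, finite_perm s & forall i, (i < size m)%N -> s i = nth 0%N m i.
Proof.
elim/last_ind: m => [_|m x IH].
  exists id => //; split; last by exists 0%N.
  exact: (@Bijective _ _ id id).
rewrite rcons_uniq => /andP[xm um]; have [s sP sm] := IH um.
(* The transposition corrects the value at the new position only: earlier values differ from
   [s (size m)] by injectivity and from [x] by uniqueness. *)
exists (swap_nat (s (size m)) x \o s); first exact: finite_perm_swap.
move=> i; rewrite size_rcons ltnS leq_eqVlt nth_rcons => /predU1P[->|im].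
  by rewrite ltnn eqxx /= /swap_nat eqxx.
rewrite im -(sm _ im) /= /swap_nat (inj_eq (bij_inj sP.1)) ltn_eqF//.
by rewrite sm//; case: eqP => // mx; move: xm; rewrite -mx mem_nth.
Qed.

(** * Compactness of the cube *)

Section cube.
Variable R : realType.
Local Notation Omega := (Omega R).

Lemma expRN_le_half n : expR (- n%:R) <= 2^-1 ^+ n :> R.
Proof.
rewrite -mulN1r expRM_natr lerXn2r ?nnegrE ?expR_ge0 ?invr_ge0//.
rewrite expRN lef_pV2 ?posrE ?expR_gt0//.
by apply: le_trans (expR_ge1Dx 1); lra.
Qed.

Lemma dist_i01_le1 (x y : {i01 R}) : `|x%:num - y%:num| <= 1.
Proof.
have x0 : 0 <= x%:num by []. have x1 : x%:num <= 1 by [].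
have y0 : 0 <= y%:num by []. have y1 : y%:num <= 1 by [].
by rewrite ler_norml; lra.
Qed.

(** Beyond the first [N] coordinates the distance is dominated by the tail of a geometric series of
    ratio 1/2. *)
Lemma tychonoff_dist_le N (x y : Omega) :
  tychonoff_dist x y <= \sum_(i < N) `|(x i)%:num - (y i)%:num| + 2 * 2^-1 ^+ N.
Proof.
apply: limr_le; first exact: is_cvg_dterm.
near=> n; have Nn : (N <= n)%N by near: n; exact: nbhs_infty_ge.
rewrite -(subnKC Nn) /series/= .
(* The subtracted term makes the induction go through: its decrease from [k] to [k + 1] is exactly
   the bound on the next summand. *)
suff : \sum_(0 <= i < N + (n - N)) dterm x y i <=
    \sum_(i < N) `|(x i)%:num - (y i)%:num| + 2 * 2^-1 ^+ N - 2 * 2^-1 ^+ (N + (n - N)).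
  by move/le_trans; apply; rewrite gerBl mulr_ge0// exprn_ge0// invr_ge0.
elim: (n - N)%N => [|k IH].
  rewrite addn0 addrK big_mkord; apply: ler_sum => i _; rewrite /dterm.
  by rewrite ler_piMl// (le_trans (expRN_le_half _))// exprn_ile1// ?invr_ge0//; lra.
rewrite addnS big_nat_recr//=.
have : dterm x y (N + k) <= 2^-1 ^+ (N + k).
  apply: le_trans (expRN_le_half _).
  by rewrite /dterm ler_piMr ?expR_ge0// dist_i01_le1.
by move: IH; rewrite [2^-1 ^+ (N + k).+1]exprS; set u := 2^-1 ^+ (N + k); set v := 2^-1 ^+ N; lra.
Unshelve. all: by end_near. Qed.

(** Along an ultrafilter every coordinate converges, by compactness of [0,1]; coordinatewise
    convergence implies [d]-convergence since the tails are uniformly small. *)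
Lemma Omega_compact : compact [set: Omega].
Proof.
rewrite compact_ultra => F FU _.
have coord n : exists l : {i01 R}, (x n)%:num @[x --> F] --> l%:num.
  have [|l [l01 lF]] := @segment_compact R 0 1 ((x n)%:num @[x --> F]) _.
    apply: nearW => x /=; rewrite in_itv/=.
    by have x0 : 0 <= (x n)%:num by []; have x1 : (x n)%:num <= 1 by []; rewrite x0.
  move: l01; rewrite /= in_itv/= => /andP[l0 l1].
  exists (Itv01 l0 l1) => /= U Ul.
  have [//|FnU] := in_ultra_setVsetC ((fun x : Omega => (x n)%:num) @^-1` U) FU.
  by have [z []] := lF (~` U) U FnU Ul.
have [l lP] := choice coord.
exists l; split => //; apply/cvg_ballP => e e0.
(* The tail gets less than [e / 2]; the first [N] coordinates share the other half. *)
have /filter_ex[N Ne] : \forall N \near \oo, 1 / 2 ^+ N < e / 4 :> R.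
  have e4 : 0 < e / 4 by rewrite divr_gt0.
  exact: (near_infty_natSinv_expn_lt (PosNum e4)).
have d0 : 0 < e / (2 * N.+1%:R) by rewrite divr_gt0.
have : F [set x : Omega | forall i : 'I_N, `|(l i)%:num - (x i)%:num| < e / (2 * N.+1%:R)].
  apply: filter_forall => i.
  by have /cvgrPdist_lt /(_ _ d0) := lP i.
apply: filterS => x xl; rewrite ballEmdist/= /mdist/=.
apply: le_lt_trans (tychonoff_dist_le N _ _) _.
have : \sum_(i < N) `|(l i)%:num - (x i)%:num| <= e / 2.
  apply: (@le_trans _ _ (\sum_(i < N) e / (2 * N.+1%:R))).
    by apply: ler_sum => i _; exact/ltW.
  rewrite sumr_const card_ord -[leLHS]mulr_natl invfM [e * _]mulrA mulrCA.
  by rewrite ler_piMr ?divr_ge0 ?(ltW e0)// ler_pdivrMr// mul1r ler_nat.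
by move: Ne; rewrite div1r -exprVn; set v := _ ^+ N; lra.
Qed.

Lemma open_ball_sub (B : set Omega) x : open B -> B x ->
  exists2 e : R, 0 < e & ball x e `<=` B.
Proof.
rewrite openE => Bo /Bo; rewrite /interior -nbhs_ballE => -[e /= e0 eB].
by exists e.
Qed.

(** A Lebesgue number argument. Near a point of [B] a small radius works uniformly; a point outside
    [B] is no cluster point, so some neighbourhood of it is eventually avoided. Compactness handles
    all large indices at once, and the finitely many others are treated one by one. *)
Lemma orbit_ball_sub (B : set Omega) (u : nat -> Omega) : open B ->
  (forall k, B (u k)) -> cluster (u k @[k --> \oo]) `<=` B ->
  exists2 d : R, 0 < d & forall k, ball (u k) d `<=` B.
Proof.
move=> Bo Bu uB.
pose P (i : nat) x := forall k, (i <= k)%N -> u k = x -> ball x i.+1%:R^-1 `<=` B.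
have : \forall i \near \oo, [set: Omega] `<=` P i.
  apply: (iffLR (compact_near_coveringP _) Omega_compact) => x _.
  have [Bx|nBx] := pselect (B x).
    have [e e0 eB] := open_ball_sub Bo Bx.
    have e20 : 0 < e / 2 by rewrite divr_gt0.
    near=> y i.
    have ie : i.+1%:R^-1 < e / 2.
      by near: i; exact: (near_infty_natSinv_lt (PosNum e20)).
    have xy : ball x (e / 2) y by near: y; exact: nbhsx_ballx.
    move=> k ik _ z yz; apply: eB.
    rewrite [e]splitr; apply: (ball_triangle xy).
    by apply: le_ball yz; exact/ltW.
  have /existsNP[U /existsNP[V /not_implyP[[K _ KU] /not_implyP[xV UV]]]] :
    ~ cluster (u k @[k --> \oo]) x by move=> /uB.
  near=> y i.
  have Ki : (K <= i)%N by near: i; exact: nbhs_infty_ge.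
  have Vy : V y by near: y.
  move=> k /= ik ky; exfalso; apply: UV; exists y; split => //.
  by rewrite -ky; apply: KU => /=; exact: (leq_trans Ki ik).
move=> /filter_ex[i iP].
have [d d0 dB] : exists2 d : R, 0 < d & forall k, (k < i)%N -> ball (u k) d `<=` B.
  elim: i {iP} => [|i [d d0 dB]]; first by exists 1.
  have [e e0 eB] := open_ball_sub Bo (Bu i).
  exists (Num.min d e) => [|k]; first by rewrite lt_min d0.
  rewrite ltnS leq_eqVlt => /predU1P[->|/dB ki].
    by apply: subset_trans eB; apply: le_ball; rewrite ge_min lexx orbT.
  by apply: subset_trans ki; apply: le_ball; rewrite ge_min lexx.
exists (Num.min d i.+1%:R^-1) => [|k]; first by rewrite lt_min d0 invr_gt0 ltr0n.
have [ki|ik] := ltnP k i.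
  by apply: subset_trans (dB _ ki); apply: le_ball; rewrite ge_min lexx.
by apply: subset_trans (iP (u k) I k ik erefl); apply: le_ball; rewrite ge_min lexx orbT.
Unshelve. all: by end_near. Qed.

Lemma Omega_totally_bounded (e : R) : 0 < e ->
  exists D : {fset Omega}, forall x, exists2 y, y \in D & ball y e x.
Proof.
move=> e0; have := Omega_compact; rewrite compact_cover.
move=> /(_ Omega setT (fun y => interior (ball y e)))[].
- by move=> y _; exact: open_interior.
- by move=> x _; exists x => //; exact: nbhsx_ballx.
- move=> D _ DP; exists D => x; have [y yD /interior_subset xy] := DP x I.
  by exists y.
Qed.

(** * Covering the good parameters *)

(** [W] is the union of those balls of radius [d / 2], centred on a finite [d / 4]-net, that lie in
    [B]. Finiteness puts it in the algebra, where [mu0] is a limit of volumes; the spare [d / 4]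
    leaves room for a grid cell. *)
Lemma ball_algebra_approx (B : set Omega) (d : R) : 0 < d ->
  exists W, [/\ ball_algebra W, W `<=` B &
    forall x, ball x d `<=` B ->
      exists2 y, ball y (d / 4) x & ball y (d / 2) `<=` W].
Proof.
move=> d0; have d4 : 0 < d / 4 by rewrite divr_gt0.
have [D DP] := Omega_totally_bounded d4.
pose E := [set y | y \in D /\ ball y (d / 2) `<=` B].
exists (\bigcup_(y in E) ball y (d / 2)); split.
- apply: setring_fin_bigcup.
    by apply: (sub_finite_set _ (finite_fset D)) => y [].
  move=> y _; apply: sub_setring; exists y, (d / 2); split => //.
  by rewrite divr_gt0.
- by move=> x [y [_ yB] /yB].
- move=> x xB; have [y yD yx] := DP x; exists y => //.
  suff yB : ball y (d / 2) `<=` B by move=> z yz; exists y.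
  move=> z yz; apply: xB.
  have -> : d = d / 4 + (d / 2 + d / 4) by lra.
  apply: (ball_triangle (ball_sym yx)); apply: le_ball yz.
  by rewrite lerDl ltW.
Qed.

Lemma measurable_ball_algebra (W : set (Xi R)) : ball_algebra W -> measurable W.
Proof.
apply: smallest_sub; first split.
- exact: measurable0.
- by move=> A A' mA mA'; exact: measurableU.
- by move=> A A' mA mA'; exact: measurableD.
- by move=> U; exact: sub_sigma_algebra.
Qed.

(** An open set is the countable union of its approximations in the algebra at scales
    [1 / (n + 1)]. *)
Lemma measurable_open (B : set (Xi R)) : open (B : set Omega) -> measurable B.
Proof.
move=> Bo.
have /choice[W WP] : forall n : nat, exists W, [/\ ball_algebra W, W `<=` B &
    forall x : Omega, ball x n.+1%:R^-1 `<=` B -> W x].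
  move=> n; have n0 : 0 < n.+1%:R^-1 :> R by rewrite invr_gt0.
  have [W [W1 W2 W3]] := ball_algebra_approx B n0; exists W; split => // x /W3[y yx].
  apply; apply: le_ball yx.
  by rewrite ler_pM2l// lef_pV2 ?posrE// ler_nat.
have -> : B = \bigcup_n W n.
  apply/seteqP; split => [x Bx|x [n _ Wx]]; last by have [_ + _] := WP n; apply.
  have [e e0 eB] := open_ball_sub Bo Bx.
  have /filter_ex[n ne] := near_infty_natSinv_lt (PosNum e0).
  exists n => //; have [_ _] := WP n; apply.
  by apply: subset_trans eB; apply: le_ball; exact: ltW.
apply: bigcupT_measurable => n; apply: measurable_ball_algebra.
by have [] := WP n.
Qed.

(** Moving inside a cell changes each of the [N] coordinates by at most [1 / M], hence the weighted
    sum by less than [d]. *)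
Lemma grid_ball_sub N (M : nat) (theta x : Omega) (d : R) (c : N.-tuple 'I_M) :
  0 < d -> (0 < M)%N -> N%:R / M%:R < d -> ball theta d x ->
  (forall i, grid_cell M (tnth c i) (x i)%:num) ->
  [set u | forall i, grid_cell M (tnth c i) (tnth u i)] `<=`
  first_coords N @` ball theta (d + d).
Proof.
move=> d0 M0 NM dx xc u uc.
have M0' : 0 < M%:R :> R by rewrite ltr0n.
rewrite first_coords_ball ?addr_gt0//; split=> [i|].
  have /andP[u1 u2] := uc i; apply/andP; split.
    by rewrite -(pmulr_rge0 _ M0') (le_trans _ u1).
  by rewrite -(ler_pM2l M0') mulr1 (le_trans (ltW u2))// ler_nat.
have xu i : `|tnth u i - (x i)%:num| <= M%:R^-1.
  have := uc i; have := xc i; rewrite /grid_cell -natr1 => /andP[x1 x2] /andP[u1 u2].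
  rewrite -[_^-1]mul1r ler_pdivlMr// -[X in _ * X]gtr0_norm// -normrM mulrC mulrBr.
  by rewrite ler_norml; lra.
apply: (@le_lt_trans _ _
  (\sum_(i < N) dterm x theta i + \sum_(i < N) M%:R^-1)); last first.
  apply: ltrD; last by rewrite sumr_const card_ord -[ltLHS]mulr_natl.
  apply: (@le_lt_trans _ _ (tychonoff_dist x theta)).
    by apply: le_trans (series_dterm_le x theta N); rewrite seriesEord.
  by move: dx; rewrite ballEmdist/= /mdist/= tychonoff_dist_sym.
rewrite -big_split/=; apply: ler_sum => i _; rewrite /dterm.
apply: (@le_trans _ _ (expR (- i%:R) *
    (`|(x i)%:num - (theta i)%:num| + `|tnth u i - (x i)%:num|))).
  by rewrite ler_wpM2l ?expR_ge0// [leRHS]addrC ler_distD.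
rewrite mulrDr lerD2l; apply: le_trans (xu i).
by rewrite ler_piMl// -expR0 ler_expR oppr_le0.
Qed.

Lemma hits_approx (mu0 : {measure set (Xi R) -> \bar R}) (L : R^nat)
    (eps : R) (B : set Omega) (d : R) : is_mu0 mu0 ->
  (forall n, 0 < L n) -> nondecreasing_seq L -> ~ has_ubound (range L) ->
  open B -> (mu0 B < eps%:E)%E -> 0 < d ->
  exists G : set (measurableTypeR R), [/\ measurable G,
    (lebesgue_measure G <= (2 * eps)%:E)%E &
    forall t, 0 <= t <= 1 ->
      (forall s, finite_perm s -> ball (permute s (frac_seq t L)) d `<=` B) ->
      G t].
Proof.
move=> hmu0 Lpos Lincr Lunb Bo muB d0.
have [W [Walg WB WP]] := ball_algebra_approx B d0.
have muW : (mu0 W < eps%:E)%E.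
  apply: le_lt_trans muB; apply: le_measure => //; rewrite inE.
    exact: measurable_ball_algebra.
  exact: measurable_open.
have /filter_ex[N volN] : \forall N \near \oo, (vol (first_coords N @` W) < eps%:E)%E.
  exact: (hmu0 W Walg _ (open_ereal_lt' muW)).
have dN : 0 < d / 4 / N.+1%:R by rewrite !divr_gt0.
have /filter_ex[M0 M0P] := near_infty_natSinv_lt (PosNum dN).
set M := M0.+1 in M0P.
have NM : N%:R / M%:R < d / 4.
  have := M0P; rewrite /= ltr_pdivlMr// mulrC; apply: le_lt_trans.
  by rewrite ler_pM2r ?invr_gt0// ler_nat.
(* With error 1 on an interval of length 1, each cell is hit on a set of measure at most
   [2 / M ^ N]: the source of the factor 2. *)
have [m [um _ mP]] :=
  measure_hits_le N 0 Lpos Lincr Lunb (ltn0Sn M0 : (0 < M)%N) (@ltr01 R).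
pose cell (c : N.-tuple 'I_M) :=
  [set u : N.-tuple R | forall i, grid_cell M (tnth c i) (tnth u i)].
pose S := finset (fun c : N.-tuple 'I_M => `[< cell c `<=` first_coords N @` W >]).
have Sle : ((#|S|%:R / M%:R ^+ N)%:E <= eps%:E :> \bar R)%E.
  apply: le_trans (ltW volN); apply: vol_ge_grid => // c.
  by rewrite finset.in_set => /asboolP.
exists (\big[setU/set0]_(c in S) hits L m c 0 1); split.
- by apply: bigsetU_measurable => c _; exact: measurable_hits.
- apply: le_trans (lebesgue_measure_bigsetU _ _ _) _.
  apply: (@le_trans _ _ (\sum_(c in S) (2 / M%:R ^+ N)%:E)%E).
    apply: lee_sum => c _; have := mP c 0 1; rewrite subr0 ler01 lexx.
    by rewrite -[1 + 1]/(2%:R); apply.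
  rewrite sumEFin lee_fin sumr_const -[leLHS]mulr_natl mulrCA ler_pM2l//.
(* The permutation [s] brings the frequencies of indices [m] to the first [N] positions, so the
   first [N] coordinates of the permuted point determine the cell containing [t]'s fractional
   parts. *)
- move=> t t01 tB; have [s sP sm] := finite_perm_extend um.
  have [y yx yW] := WP _ (tB s sP).
  have xE (i : 'I_N) : (permute s (frac_seq t L) i)%:num = Defs.frac (t * L (tnth m i)).
    by rewrite /permute /= sm ?size_tuple// (tnth_nth 0%N).
  (* The cell index is less than [M] because a fractional part is strictly below 1. *)
  have cM (i : 'I_N) : (Num.truncn (M%:R * Defs.frac (t * L (tnth m i))) < M)%N.
    rewrite truncn_lt_nat ?mulr_ge0// ?frac_ge0// gtr_pMr ?ltr0n//.
    by rewrite /Defs.frac ltrBlDl -(intrD _ _ 1) floorD1_gt.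
  pose c := [tuple Ordinal (cM i) | i < N].
  have xc i : grid_cell M (tnth c i) (Defs.frac (t * L (tnth m i))).
    rewrite tnth_mktuple /grid_cell /=; apply: truncn_itv.
    by rewrite mulr_ge0// frac_ge0.
  rewrite -bigcup_seq_cond /=; exists c; last by split.
  rewrite /= mem_index_enum finset.in_set; apply/asboolP.
  have d4 : 0 < d / 4 by rewrite divr_gt0.
  suff cellW : cell c `<=` first_coords N @` ball y (d / 2).
    by apply: (subset_trans cellW); exact: image_subset.
  have -> : d / 2 = d / 4 + d / 4 by lra.
  by apply: grid_ball_sub NM yx _ => // i; rewrite xE.
Qed.

End cube.

(** * Passage to the limit *)

(** The tail intersections increase with [k] and each lies in [G k], so continuity from below
    applies. *)
Lemma measure_liminf_le (R : realType) d (T : measurableType d)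
    (mu : {measure set T -> \bar R}) (G : (set T)^nat) (x : \bar R) :
  (forall k, measurable (G k)) -> (forall k, mu (G k) <= x)%E ->
  (mu (\bigcup_k \bigcap_(j in [set j | (k <= j)%N]) G j) <= x)%E.
Proof.
move=> mG Gx; pose F k := \bigcap_(j in [set j | (k <= j)%N]) G j.
have mF k : measurable (F k) by exact: bigcap_measurableType.
have := @nondecreasing_cvg_mu _ _ _ mu F mF (bigcupT_measurable F mF).
have ndF : nondecreasing_seq F.
  move=> k l kl; apply/subsetPset => t Ft j /= lj.
  by apply: Ft => /=; exact: leq_trans lj.
move=> /(_ ndF) muF; rewrite -(cvg_lim _ muF)//.
apply: lime_le; first by apply/cvg_ex; eexists; exact: muF.
apply: nearW => k; apply: le_trans (Gx k); apply: le_measure; rewrite ?inE//.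
by apply: bigcap_inf => /=.
Qed.

(* lebesgue_measure is total: on every set of reals it is the Lebesgue outer
   measure, which is what it denotes here when the set is not measurable. *)
Theorem lemma2 (R : realType) : exists c0 : R, 0 < c0 /\
  forall (mu0 : {measure set (Xi R) -> \bar R}) (hmu0 : is_mu0 mu0)
    (sg : nat -> nat -> nat) (hsg : set_bij [set: nat] finite_perm sg)
    (A : set (Omega R)) (Asym : finite_symmetric A) (A0 : zero_measure mu0 A)
    (L : R^nat) (Lpos : forall n, 0 < L n) (Lincr : nondecreasing_seq L)
    (Lunb : ~ has_ubound (range L)) (Lind : rat_independent L)
    (eps : R) (eps0 : 0 < eps)
    (B : set (Omega R)) (AB : A `<=` B) (Bopen : open B)
    (muB : (mu0 B < eps%:E)%E),
  (lebesgue_measure [set t : R | (0 <= t <= 1)%R /\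
      A (frac_seq t L) /\ limit_points sg (frac_seq t L) `<=` B]
    <= (c0 * eps)%:E)%E.
Proof.
exists 2; split => // mu0 hmu0 sg [sgP _ sg_surj] A Asym _ L Lpos Lincr Lunb _.
move=> eps _ B AB Bo muB.
have n0 (n : nat) : 0 < n.+1%:R^-1 :> R by rewrite invr_gt0.
have /choice[G GP] := fun n => hits_approx hmu0 Lpos Lincr Lunb Bo muB (n0 n).
(* The admissible radius depends on [t], but once it exceeds [1 / (j + 1)] the point [t] lies in
   [G j] for that and all later [j]. *)
apply: (@le_trans _ _ (lebesgue_measure
    (\bigcup_k \bigcap_(j in [set j | (k <= j)%N]) G j))); last first.
  by apply: measure_liminf_le => k; have [] := GP k.
apply: le_lebesgue_measure => t /= [t01 [At tB]].
have orbB k : B (permute (sg k) (frac_seq t L)).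
  by apply: AB; apply: Asym => //; exact: sgP.
have [d d0 dB] := orbit_ball_sub Bo orbB tB.
have [K _ KP] := near_infty_natSinv_lt (PosNum d0).
exists K => // j /= Kj; have [_ _] := GP j; apply => // s sP.
have [k _ <-] := sg_surj s sP.
by apply: subset_trans (dB k); apply: le_ball; apply/ltW; exact: KP.
Qed.
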